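(* Let $M=\begin{pmatrix} x_1 & x_2 & x_3\\ y_1 & y_2 & y_3\end{pmatrix}$ be an integer matrix with $\frac{y_1}{x_1}<\frac{y_2}{x_2}<\frac{y_3}{x_3}$, put $Y_{ij}=x_iy_j-x_jy_i$ for $i<j$, and suppose that $M$ is a 1-prime matrix. Let $f_{12},g_{12},f_{13},g_{13},f_{23},g_{23}\in\mathbb Z$ satisfy $$\gcd(f_{12}Y_{13}+g_{12}Y_{23},Y_{12})=1,\quad \gcd(f_{13}Y_{12}+g_{13}Y_{23},Y_{13})=1,\quad \gcd(f_{23}Y_{13}+g_{23}Y_{12},Y_{23})=1,$$ and let $(f_{12}Y_{13}+g_{12}Y_{23})^{-1}$, $(f_{13}Y_{12}+g_{13}Y_{23})^{-1}$, $(f_{23}Y_{13}+g_{23}Y_{12})^{-1}$ denote integers that are inverses of the respective numbers modulo $Y_{12}$, $Y_{13}$, $Y_{23}$. When $\mathbf n=(n_1,n_2)^T\in\overline{\Omega}_1\cap\mathbb Z^2$, $$\begin{aligned} t(\mathbf n|M)=\ &\frac{n_2x_1-n_1y_1}{Y_{12}Y_{13}}-\left\{\frac{(f_{12}Y_{13}+g_{12}Y_{23})^{-1}\bigl(n_2(f_{12}x_1+g_{12}x_2)-n_1(f_{12}y_1+g_{12}y_2)\bigr)}{Y_{12}}\right\}\\ &-\left\{\frac{(f_{13}Y_{12}+g_{13}Y_{23})^{-1}\bigl(n_2(f_{13}x_1+g_{13}x_3)-n_1(f_{13}y_1+g_{13}y_3)\bigr)}{Y_{13}}\right\}+1. \end{aligned}$$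 When $\mathbf n=(n_1,n_2)^T\in\overline{\Omega}_2\cap\mathbb Z^2$, $$\begin{aligned} t(\mathbf n|M)=\ &\frac{n_1y_3-n_2x_3}{Y_{23}Y_{13}}-\left\{\frac{(f_{23}Y_{13}+g_{23}Y_{12})^{-1}\bigl(n_1(f_{23}x_3+g_{23}x_2)-n_2(f_{23}y_3+g_{23}y_2)\bigr)}{Y_{23}}\right\}\\ &-\left\{\frac{(f_{13}Y_{12}+g_{13}Y_{23})^{-1}\bigl(n_1(f_{13}x_1+g_{13}x_3)-n_2(f_{13}y_1+g_{13}y_3)\bigr)}{Y_{13}}\right\}+1. \end{aligned}$$
   Context: For a $2\times 3$ integer matrix $M$ whose columns have convex hull not containing the origin, the vector partition function is $t(\mathbf b|M)=\#\{\mathbf x\in\mathbb Z_{\ge 0}^3 : M\mathbf x=\mathbf b\}$ for $\mathbf b\in\mathbb Z^2$. The $2\times 3$ matrix $M$ is 1-prime if the gcd of the absolute values of its nonzero $2\times 2$ minors is $1$. $\mathrm{cone}(M)$ is the set of nonnegative real combinations of the columns of $M$; $\Omega_1=\{(x,y)^T\in\mathrm{cone}(M): \frac{y_1}{x_1}<\frac yx<\frac{y_2}{x_2}\}$ and $\Omega_2=\{(x,y)^T\in\mathrm{cone}(M): \frac{y_2}{x_2}<\frac yx<\frac{y_3}{x_3}\}$, and the bar denotes closure. $\{x\}=x-\lfloor x\rfloor$ is the fractional part of $x$.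
   Formalization: The x_i are assumed to have the same sign (false otherwise), and misprints are fixed: in the Ω1 Y13-brace g13x3, g13y3 change sign; in the Ω2 Y23-brace x and y are swapped; the Ω2 Y13-brace numerator is n1(−f13y1+g13y3)−n2(−f13x1+g13x3). *)

(* Defs.v *)
From HB Require Import structures.
From mathcomp Require Import all_boot all_order all_algebra.
From mathcomp Require Import finmap.
From mathcomp Require Import all_classical all_reals all_analysis.
Set Implicit Arguments.
Unset Strict Implicit.
Unset Printing Implicit Defensive.
Import Order.TTheory GRing.Theory Num.Theory.
Import numFieldNormedType.Exports.
Local Open Scope classical_set_scope.
Local Open Scope ring_scope.

Definition mat23 (x1 x2 x3 y1 y2 y3 : int) : 'M[int]_(2, 3) :=
  \matrix_(i, j) nth 0 (nth [::] [:: [:: x1; x2; x3]; [:: y1; y2; y3]] i) j.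

Definition vec2 (n1 n2 : int) : 'cV[int]_2 := \col_i nth 0 [:: n1; n2] i.

(* [fset_set] sends an infinite set to the empty one, so this is the number of
   solutions only when there are finitely many of them; that is the case as
   soon as the convex hull of the columns of M misses the origin. *)
Definition vpf (M : 'M[int]_(2, 3)) (b : 'cV[int]_2) : nat :=
  #|` fset_set [set x : 'cV[nat]_3 | M *m map_mx Posz x = b] |%fset.

Definition minor2 (M : 'M[int]_(2, 3)) (i j : 'I_3) : int :=
  \det (\matrix_(k < 2, l < 2) M k (nth i [:: i; j] l)).

Definition one_prime (M : 'M[int]_(2, 3)) : Prop :=
  \big[gcdn/0%N]_(p : 'I_3 * 'I_3 | (p.1 < p.2)%N && (minor2 M p.1 p.2 != 0))
    `|minor2 M p.1 p.2|%N = 1%N.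

Section Geometry.
Variable R : realType.
Implicit Type M : 'M[int]_(2, 3).

Definition intmx_real {m n} (A : 'M[int]_(m, n)) : 'M[R]_(m, n) :=
  map_mx (fun k : int => k%:~R) A.

Definition cone M : set 'cV[R]_2 :=
  [set v | exists2 w : 'cV[R]_3, (forall j, 0 <= w j 0) & v = intmx_real M *m w].

Definition conv_hull M : set 'cV[R]_2 :=
  [set v | exists w : 'cV[R]_3,
     [/\ forall j, 0 <= w j 0, \sum_j w j 0 = 1 & v = intmx_real M *m w]].

Definition slope (v : 'cV[R]_2) : R := v 1 0 / v 0 0.

(* Division by 0 returns 0, so the points without a slope are excluded
   explicitly (otherwise 0 could lie in the chamber). *)
Definition chamber M (i j : 'I_3) : set 'cV[R]_2 :=
  [set v | [/\ cone M v, v 0 0 != 0,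
               slope (col i (intmx_real M)) < slope v
             & slope v < slope (col j (intmx_real M))]].

Definition Omega1 M := chamber M 0 1.
Definition Omega2 M := chamber M 1 ord_max.

Definition fracpart (x : R) : R := x - (Num.floor x)%:~R.

End Geometry.

Arguments intmx_real R {m n} A.
Arguments cone R M : clear implicits.
Arguments conv_hull R M : clear implicits.
Arguments chamber R M i j : clear implicits.
Arguments Omega1 R M : clear implicits.
Arguments Omega2 R M : clear implicits.

(* Main.v *)
(* Write Y12, Y13, Y23 for the minors; they are positive, and the integer kernel
   of M is spanned by (Y23, -Y13, Y12) since their gcd is 1.  By Bezout and
   Cramer's rule M u = n has an integer solution u, so t(n|M) counts the integers
   t for which u + t (Y23, -Y13, Y12) is nonnegative.  The middle coordinate
   bounds t from above by floor(u_2 / Y13).  Of the two lower bounds, given by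
   the outer coordinates, the one from u_3 is the binding one on the closure of
   Omega_1 and the one from u_1 on the closure of Omega_2.  For instance on the
   closure of Omega_1 the count is
     floor(u_2 / Y13) + floor(u_3 / Y12) + 1,
   and Y12 u_2 + Y13 u_3 = n_2 x_1 - n_1 y_1.  Reducing the arguments of the
   fractional parts in the theorem modulo Y12 and Y13 gives u_3 and u_2. *)
Require Import Defs.
From mathcomp Require Import all_boot all_order all_algebra finmap.
From mathcomp Require Import all_classical all_reals all_analysis.
From mathcomp Require Import ring zify.
Import Order.TTheory GRing.Theory Num.Theory.
Import numFieldNormedType.Exports.
Local Open Scope classical_set_scope.
Local Open Scope ring_scope.

(** * Counting points on a lattice line *)

(** As [k != 0], distinct [t] give distinct points, so the solutions are enumerated by ['I_N]. This
    also proves finiteness, without which [fset_set] would be empty by default. *)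
Lemma vpf_segment (M : 'M[int]_(2, 3)) (b : 'cV[int]_2) (u k : 'cV[int]_3)
    (p : int) (N : nat) :
  k != 0 ->
  (forall w, M *m w = b <-> exists t : int, w = u + t *: k) ->
  (forall t : int,
     (forall i, 0 <= (u + t *: k) i 0) <-> p <= t < p + N%:Z) ->
  vpf M b = N.
Proof.
move=> k_neq0 solP posP.
have [i0 ki0] : exists i, k i 0 != 0.
  apply/existsP; apply: contraNT k_neq0; rewrite negb_exists => /forallP k0.
  by apply/eqP/matrixP => i l; rewrite ord1 mxE; apply/eqP/negPn/k0.
(* [absz] loses nothing here: these points are nonnegative by [posP]. *)
pose F (j : 'I_N) : 'cV[nat]_3 :=
  map_mx absz (u + (p + (j : nat)%:Z) *: k).
have FE j : map_mx Posz (F j) = u + (p + (j : nat)%:Z) *: k.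
  apply/matrixP => i l; rewrite [l]ord1 !mxE.
  have /posP/(_ i) : p <= p + (j : nat)%:Z < p + N%:Z.
    by rewrite lerDl ltrD2l ltz_nat ltn_ord.
  by rewrite !mxE; case: (_ + _).
have Finj : injective F.
  move=> j l /(congr1 (map_mx Posz)); rewrite !FE => /addrI /matrixP/(_ i0 0).
  by rewrite !mxE => /(mulIf ki0) /addrI [] /val_inj.
rewrite /vpf.
have -> : [set x | M *m map_mx Posz x = b] = [set` [fset F j | j in 'I_N]%fset].
  apply/seteqP; split => x /=.
    move=> /solP[t xE].
    have /posP /andP[pt tN] : forall i, 0 <= (u + t *: k) i 0.
      by move=> i; rewrite -xE mxE.
    have tpN : (`|(t - p)%R| < N)%N.
      by rewrite -ltz_nat gez0_abs ?subr_ge0// ltrBlDl.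
    apply/imfsetP; exists (Ordinal tpN) => //.
    have: map_mx Posz x = map_mx Posz (F (Ordinal tpN)).
      by rewrite FE xE /= gez0_abs ?subr_ge0// subrKC.
    move=> /matrixP e; apply/matrixP => i l.
    by have := e i l; rewrite !mxE => -[].
  case/imfsetP => j _ -> /=; rewrite FE.
  by apply/solP; exists (p + (j : nat)%:Z).
by rewrite set_fsetK card_imfset//= -cardE card_ord.
Qed.

(** Cleared of denominators and weakened, each slope bound defines a closed half-plane, so it
    survives passage to the closure. *)
Lemma closure_chamber (R : realType) (M : 'M[int]_(2, 3)) (i j : 'I_3)
    (v : 'cV[R]_2) :
  (forall k l, 0 < M 0 k * M 0 l) -> closure (chamber R M i j) v ->
  0 <= (M 0 i)%:~R * v 1 0 - (M 1 i)%:~R * v 0 0 /\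
  0 <= (M 1 j)%:~R * v 0 0 - (M 0 j)%:~R * v 1 0.
Proof.
move=> sameM clv.
have M0 l : (M 0 l)%:~R != 0 :> R.
  by rewrite intr_eq0; apply: contraTneq (sameM l l) => ->; rewrite mul0r.
have half_plane (a b : R) :
    (forall u, chamber R M i j u -> 0 <= a * u 0 0 + b * u 1 0) ->
    0 <= a * v 0 0 + b * v 1 0.
  move=> le0; pose h (u : 'cV[R]_2) := a * u 0 0 + b * u 1 0.
  have clh : closed (h @^-1` [set x | 0 <= x]).
    apply: preimage_closed; last exact: closed_ge.
    move=> u _.
    have coordM c k : {for u, continuous (fun w : 'cV[R]_2 => c * w k 0)}.
      by apply: continuousM; [exact: cst_continuous | exact: coord_continuous].
    exact: continuousD (coordM a 0) (coordM b 1).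
  by have /clh := closureS le0 clv.
(* A nonnegative combination of columns whose abscissas share a sign keeps that sign, so multiplying
   by this product preserves the slope inequalities. *)
have sameu l u : chamber R M i j u -> 0 < (M 0 l)%:~R * u 0 0.
  case=> -[w w0 ->] u0 _ _; rewrite lt_neqAle eq_sym mulf_neq0//=.
  rewrite mxE mulr_sumr sumr_ge0// => k _.
  by rewrite mxE mulrA mulr_ge0// -intrM ler0z ltW.
split.
  rewrite addrC -mulNr; apply: half_plane => u cu.
  have [_ u0 + _] := cu; rewrite /slope !mxE => /ltW.
  rewrite -(ler_pM2r (sameu i _ cu)).
  have -> : (M 1 i)%:~R / (M 0 i)%:~R * ((M 0 i)%:~R * u 0 0) =
      (M 1 i)%:~R * u 0 0 by (field; exact: M0).
  have -> : u 1 0 / u 0 0 * ((M 0 i)%:~R * u 0 0) =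
      (M 0 i)%:~R * u 1 0 by field.
  by rewrite mulNr addrC subr_ge0.
rewrite -mulNr; apply: half_plane => u cu.
have [_ u0 _] := cu; rewrite /slope !mxE => /ltW.
rewrite -(ler_pM2r (sameu j _ cu)).
have -> : (M 1 j)%:~R / (M 0 j)%:~R * ((M 0 j)%:~R * u 0 0) =
    (M 1 j)%:~R * u 0 0 by (field; exact: M0).
have -> : u 1 0 / u 0 0 * ((M 0 j)%:~R * u 0 0) =
    (M 0 j)%:~R * u 1 0 by field.
by rewrite mulNr subr_ge0.
Qed.

(** * Floors and fractional parts *)

Lemma fracpart_div (R : realType) (a d : int) : 0 < d ->
  fracpart (a%:~R / d%:~R) = (a %% d)%Z%:~R / d%:~R :> R.
Proof.
move=> d0; have dR : 0 < d%:~R :> R by rewrite ltr0z.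
rewrite /fracpart.
have -> : Num.floor (a%:~R / d%:~R : R) = (a %/ d)%Z.
  apply: floor_def; rewrite ler_pdivlMr// ltr_pdivrMr// -!intrM ler_int ltr_int.
  by rewrite -lez_divRL// lexx /= ltz_ceil.
rewrite {1}(divz_eq a d) intrD intrM; field; exact: lt0r_neq0.
Qed.

Lemma fracpart_modz (R : realType) (a b d : int) : 0 < d ->
  (a = b %[mod d])%Z ->
  fracpart (a%:~R / d%:~R) = fracpart (b%:~R / d%:~R) :> R.
Proof. by move=> d0 ab; rewrite !fracpart_div// ab. Qed.

(** Since [c/e + b/d >= 0] and each floor loses less than 1, the two floors add up to an integer
    above -2. Hence [absz] of this count is harmless. *)
Lemma addz_div_ge (b c d e : int) : 0 < d -> 0 < e ->
  0 <= b * e + c * d -> 0 <= (c %/ e)%Z + (b %/ d)%Z + 1.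
Proof.
move=> d0 e0 bc0; have := ltz_pmod c e0; have := ltz_pmod b d0.
have : 0 <= ((b %/ d)%Z * d + (b %% d)%Z) * e + ((c %/ e)%Z * e + (c %% e)%Z) * d.
  by rewrite -!divz_eq.
move: (c %% e)%Z (b %% d)%Z (c %/ e)%Z (b %/ d)%Z => r r' q q' {}bc0 r'd re.
rewrite leNgt -lezD1; apply/negP => q0.
have : (q + q' + 1 + 1) * (d * e) <= 0.
  by apply: mulr_le0_ge0 => //; rewrite mulr_ge0// ltW.
have : r * d < e * d by rewrite ltr_pM2r.
have : r' * e < d * e by rewrite ltr_pM2r.
lia.
Qed.

Lemma sum_floor_fracpart (R : realType) (b c d e : int) : 0 < d -> 0 < e ->
  0 <= b * e + c * d ->
  `|((c %/ e)%Z + (b %/ d)%Z + 1)%R|%N%:R =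
    (b * e + c * d)%:~R / (e * d)%:~R
    - fracpart (c%:~R / e%:~R) - fracpart (b%:~R / d%:~R) + 1 :> R.
Proof.
move=> d0 e0 bc0.
rewrite -[_%:R]/(Posz _)%:~R gez0_abs ?addz_div_ge// !fracpart_div//.
have dR : d%:~R != 0 :> R by rewrite intr_eq0 gt_eqF.
have eR : e%:~R != 0 :> R by rewrite intr_eq0 gt_eqF.
rewrite {2}(divz_eq b d) {2}(divz_eq c e) !(intrD, intrM); field.
exact/andP.
Qed.

(** * Integer solutions of the linear system *)

Lemma ord3P (i : 'I_3) : [\/ i = 0, i = 1 | i = 2].
Proof.
by case: i => [[|[|[|]]] i3] //; [apply: Or31 | apply: Or32 | apply: Or33];
  apply: val_inj.
Qed.

Lemma minor2_mat23 (x1 x2 x3 y1 y2 y3 : int) (i j : 'I_3) :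
  minor2 (mat23 x1 x2 x3 y1 y2 y3) i j =
  [:: x1; x2; x3]`_i * [:: y1; y2; y3]`_j -
  [:: x1; x2; x3]`_j * [:: y1; y2; y3]`_i.
Proof.
rewrite /minor2 (expand_det_row _ 0) !big_ord_recl big_ord0 /cofactor !det_mx11.
rewrite !mxE /= /bump /= ?mxE /=. ring.
Qed.

(** The gcd obtained from two Bezout steps divides every minor, hence also the gcd of the nonzero
    ones, which is 1. *)
Lemma one_prime_Bezout (x1 x2 x3 y1 y2 y3 : int) :
  one_prime (mat23 x1 x2 x3 y1 y2 y3) ->
  exists a b c : int,
    a * (x1 * y2 - x2 * y1) + b * (x1 * y3 - x3 * y1) +
    c * (x2 * y3 - x3 * y2) = 1.
Proof.
set Y12 := x1 * y2 - x2 * y1; set Y13 := x1 * y3 - x3 * y1.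
set Y23 := x2 * y3 - x3 * y2 => prM.
have [a [b abE]] := Bezoutz Y12 Y13.
have [u [v uvE]] := Bezoutz (gcdz Y12 Y13) Y23.
exists (u * a), (u * b), v.
rewrite -!mulrA -mulrDr abE uvE; apply/eqP.
rewrite -[1]/(1%:Z) eqz_nat -dvdn1 -prM.
apply/dvdn_biggcdP => -[i j] /andP[/= + _]; rewrite minor2_mat23.
have d3 : (`|gcdz (gcdz Y12 Y13) Y23| %| `|Y23|)%N by exact: dvdz_gcdr.
have d12 : (`|gcdz (gcdz Y12 Y13) Y23| %| `|gcdz Y12 Y13|)%N by exact: dvdz_gcdl.
case: i j => [[|[|[|i]]] i3] [[|[|[|j]]] j3] //= _.
- by apply: (dvdn_trans d12); exact: dvdz_gcdl.
- by apply: (dvdn_trans d12); exact: dvdz_gcdr.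
Qed.

Lemma mulmx_mat23 (x1 x2 x3 y1 y2 y3 n1 n2 : int) (w : 'cV[int]_3) :
  mat23 x1 x2 x3 y1 y2 y3 *m w = vec2 n1 n2 <->
  x1 * w 0 0 + x2 * w 1 0 + x3 * w 2 0 = n1 /\
  y1 * w 0 0 + y2 * w 1 0 + y3 * w 2 0 = n2.
Proof.
split=> [/matrixP e | [e1 e2]].
  have := e 0 0; have := e 1 0; rewrite !mxE !big_ord_recl !big_ord0 /= !mxE /=.
  rewrite !addr0 !addrA => <- <-; split;
    congr (_ * w _ 0 + _ * w _ 0 + _ * w _ 0); exact: val_inj.
apply/matrixP => i j; rewrite [j]ord1 !mxE !big_ord_recl !big_ord0 /= !mxE /=.
case: i => [[|[|]]] //= _; rewrite !addr0 !addrA -?e1 -?e2;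
  congr (_ * w _ 0 + _ * w _ 0 + _ * w _ 0); exact: val_inj.
Qed.

Lemma mat23_solutions (x1 x2 x3 y1 y2 y3 n1 n2 : int) :
  let M := mat23 x1 x2 x3 y1 y2 y3 in
  one_prime M ->
  exists2 u : 'cV[int]_3, M *m u = vec2 n1 n2 &
    forall w, M *m w = vec2 n1 n2 <-> exists t : int,
      w = u + t *: \col_i
        [:: x2 * y3 - x3 * y2; - (x1 * y3 - x3 * y1); x1 * y2 - x2 * y1]`_i.
Proof.
move=> M /one_prime_Bezout[a [b [c bez]]].
pose D i := let x := [:: x1; x2; x3]`_i in let y := [:: y1; y2; y3]`_i in
  x * n2 - y * n1.
(* For each pair of columns, Cramer's rule solves the system with right side multiplied by their
   minor; [u] combines the three solutions with weights [a], [b], [c]. *)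
pose u : 'cV[int]_3 := \col_i
  [:: - a * D 1 - b * D 2; a * D 0 - c * D 2; b * D 0 + c * D 1]`_i.
have Mu : M *m u = vec2 n1 n2.
  apply/mulmx_mat23; rewrite !mxE /= /D /=.
  by split; [rewrite -[RHS]mulr1 | rewrite -[RHS]mulr1]; rewrite -bez; ring.
exists u => // w; split=> [Mw | [t ->]]; last first.
  rewrite mulmxDr Mu -scalemxAr (_ : M *m _ = vec2 0 0).
    apply/matrixP => i j; rewrite !mxE.
    by case: i => [[|[|]]] //= _; rewrite mulr0 addr0.
  by apply/mulmx_mat23; rewrite !mxE /=; split; ring.
have /mulmx_mat23[e1 e2] : M *m (w - u) = vec2 0 0.
  rewrite mulmxBr Mw Mu subrr; apply/matrixP => i j; rewrite !mxE.
  by case: i => [[|[|]]].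
set v := w - u in e1 e2.
(* If [v] is [t] times (Y23, -Y13, Y12), this expression is [t] by [bez]. Proportionality comes from
   eliminating one unknown at a time from [e1] and [e2]. *)
exists (a * v 2 0 - b * v 1 0 + c * v 0 0).
rewrite -[LHS](subrKC u) -/v; congr (_ + _); clearbody v.
have z12 : v 0 0 * (x1 * y2 - x2 * y1) = v 2 0 * (x2 * y3 - x3 * y2).
  have /= := congr2 (fun p q => p * y2 - q * x2) e1 e2; lia.
have z13 : v 0 0 * (x1 * y3 - x3 * y1) = - v 1 0 * (x2 * y3 - x3 * y2).
  have /= := congr2 (fun p q => p * y3 - q * x3) e1 e2; lia.
have z23 : v 1 0 * (x1 * y2 - x2 * y1) = - v 2 0 * (x1 * y3 - x3 * y1).
  have /= := congr2 (fun p q => p * y1 - q * x1) e1 e2; lia.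
have vE i : v i 0 = a * (v i 0 * (x1 * y2 - x2 * y1)) +
    b * (v i 0 * (x1 * y3 - x3 * y1)) + c * (v i 0 * (x2 * y3 - x3 * y2)).
  by rewrite !(mulrCA _ (v i 0)) -!mulrDr bez mulr1.
apply/matrixP => i j; rewrite [j]ord1 !mxE.
case: (ord3P i) => -> /=.
- rewrite {1}vE z12 z13; ring.
- rewrite {1}vE z23.
  have -> : v 1 0 * (x2 * y3 - x3 * y2) = - v 0 0 * (x1 * y3 - x3 * y1) by lia.
  ring.
- rewrite {1}vE -z12.
  have -> : v 2 0 * (x1 * y3 - x3 * y1) = - v 1 0 * (x1 * y2 - x2 * y1) by lia.
  ring.
Qed.

(** Coordinates [i] and [j] bound [t] from below, [l] from above. The comparison
    [u_j / k_j <= u_i / k_i] makes the bound from [j] the binding one. *)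
Lemma vpf_divz (M : 'M[int]_(2, 3)) (b : 'cV[int]_2) (u k : 'cV[int]_3)
    (i j l : 'I_3) :
  (forall w, M *m w = b <-> exists t : int, w = u + t *: k) ->
  (forall m, [\/ m = i, m = j | m = l]) ->
  0 < k i 0 -> 0 < k j 0 -> k l 0 < 0 ->
  u j 0 * k i 0 <= u i 0 * k j 0 ->
  0 <= u l 0 * k j 0 + u j 0 * - k l 0 ->
  vpf M b = `|(divz (u j 0) (k j 0) + divz (u l 0) (- k l 0) + 1)%R|%N.
Proof.
move=> solP all3 ki kj kl uij ulj.
have kl' : 0 < - k l 0 by rewrite oppr_gt0.
apply: (vpf_segment _ _ u k (- divz (u j 0) (k j 0)) _ _ solP).
  by apply: contraTneq ki => ->; rewrite mxE ltxx.
move=> t; rewrite gez0_abs ?addz_div_ge//.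
have tj : (- divz (u j 0) (k j 0) <= t) = (0 <= (u + t *: k) j 0).
  by rewrite lerNl lez_divRL// !mxE mulNr -subr_ge0 opprK.
(* The [+ 1] turns the inclusive upper bound on [t] into a strict one. *)
have tl : (t < - divz (u j 0) (k j 0) +
    (divz (u j 0) (k j 0) + divz (u l 0) (- k l 0) + 1)) = (0 <= (u + t *: k) l 0).
  by rewrite -addrA addKr ltzD1 lez_divRL// !mxE mulrN -subr_ge0 opprK.
rewrite tj tl; split=> [pos | /andP[posj posl] m]; first by rewrite !pos.
case: (all3 m) => -> //.
rewrite -(pmulr_lge0 _ kj); move: posj.
rewrite -(pmulr_lge0 ((u + _) j 0) ki) !mxE.
by move=> /le_trans; apply; rewrite !mulrDl (mulrAC t) lerD2r.
Qed.

Lemma slope_lt_minor_gt0 (R : realType) (x y x' y' : int) :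
  0 < x * x' -> y%:~R / x%:~R < y'%:~R / x'%:~R :> R -> 0 < x * y' - x' * y.
Proof.
move=> xx'; have xx'R : 0 < x%:~R * x'%:~R :> R by rewrite -intrM ltr0z.
have := lt0r_neq0 xx'R; rewrite mulf_eq0 negb_or => /andP[x0 x'0].
rewrite -(ltr_pM2r xx'R) -(ltr0z R) intrB !intrM.
have -> : y%:~R / x%:~R * (x%:~R * x'%:~R) = x'%:~R * y%:~R :> R by field.
have -> : y'%:~R / x'%:~R * (x%:~R * x'%:~R) = x%:~R * y'%:~R :> R by field.
by rewrite subr_gt0.
Qed.

(** The [x_i] share a sign, so increasing slopes give positive minors. Modulo [Y13],
    [n2 * x1 - n1 * y1] is [u_2 Y12] but [n2 * x3 - n1 * y3] is [- u_2 Y23]; hence the opposite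
    signs of [f13] and [g13]. *)
Theorem theorem7 (R : realType) (x1 x2 x3 y1 y2 y3 : int)
    (f12 g12 f13 g13 f23 g23 h12 h13 h23 : int) :
  let M := mat23 x1 x2 x3 y1 y2 y3 in
  let Y12 : int := x1 * y2 - x2 * y1 in
  let Y13 : int := x1 * y3 - x3 * y1 in
  let Y23 : int := x2 * y3 - x3 * y2 in
  ~ conv_hull R M 0 ->
  [/\ 0 < x1 * x2, 0 < x1 * x3 & 0 < x2 * x3] ->
  y1%:~R / x1%:~R < y2%:~R / x2%:~R :> R ->
  y2%:~R / x2%:~R < y3%:~R / x3%:~R :> R ->
  one_prime M ->
  gcdz (f12 * Y13 + g12 * Y23) Y12 = 1 ->
  gcdz (f13 * Y12 + g13 * Y23) Y13 = 1 ->
  gcdz (f23 * Y13 + g23 * Y12) Y23 = 1 ->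
  (h12 * (f12 * Y13 + g12 * Y23) = 1 %[mod Y12])%Z ->
  (h13 * (f13 * Y12 + g13 * Y23) = 1 %[mod Y13])%Z ->
  (h23 * (f23 * Y13 + g23 * Y12) = 1 %[mod Y23])%Z ->
  (forall n1 n2 : int,
     closure (Omega1 R M) (intmx_real R (vec2 n1 n2)) ->
     (vpf M (vec2 n1 n2))%:R =
       (n2 * x1 - n1 * y1)%:~R / (Y12 * Y13)%:~R
       - fracpart ((h12 * (n2 * (f12 * x1 + g12 * x2)
                           - n1 * (f12 * y1 + g12 * y2)))%:~R / Y12%:~R)
       - fracpart ((h13 * (n2 * (f13 * x1 - g13 * x3)
                           - n1 * (f13 * y1 - g13 * y3)))%:~R / Y13%:~R)
       + 1 :> R)
  /\
  (forall n1 n2 : int,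
     closure (Omega2 R M) (intmx_real R (vec2 n1 n2)) ->
     (vpf M (vec2 n1 n2))%:R =
       (n1 * y3 - n2 * x3)%:~R / (Y23 * Y13)%:~R
       - fracpart ((h23 * (n1 * (f23 * y3 + g23 * y2)
                           - n2 * (f23 * x3 + g23 * x2)))%:~R / Y23%:~R)
       - fracpart ((h13 * (n1 * (- f13 * y1 + g13 * y3)
                           - n2 * (- f13 * x1 + g13 * x3)))%:~R / Y13%:~R)
       + 1 :> R).
Proof.
move=> M Y12 Y13 Y23 _ [x12 x13 x23] s12 s23 prM _ _ _ h12E h13E h23E.
have sameM k l : 0 < M 0 k * M 0 l.
  have sq (x y : int) : 0 < x * y -> 0 < x * x.
    by rewrite -expr2 exprn_even_gt0//=; apply: contraTneq => ->; rewrite mul0r.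
  rewrite !mxE; case: (ord3P k) => ->; case: (ord3P l) => -> /=;
    rewrite // 1?mulrC//; [exact: sq x12 | exact: sq x23 | ].
  by rewrite mulrC in x13; exact: sq x13.
have Y12_gt0 : 0 < Y12 by exact: (slope_lt_minor_gt0 R _ _ _ _ x12 s12).
have Y23_gt0 : 0 < Y23 by exact: (slope_lt_minor_gt0 R _ _ _ _ x23 s23).
have Y13_gt0 : 0 < Y13.
  by exact: (slope_lt_minor_gt0 R _ _ _ _ x13 (lt_trans s12 s23)).
split=> n1 n2 /(closure_chamber _ _ _ _ _ sameM) [];
  rewrite !mxE /= -!intrM -!intrB !ler0z.
all: move=> ge1 ge2.
all: have [u /mulmx_mat23[e1 e2]] := mat23_solutions _ _ _ _ _ _ n1 n2 prM.
all: rewrite -/Y12 -/Y13 -/Y23; set k : 'cV[int]_3 := \col_i _ => solP.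
all: have k0 : k 0 0 = Y23 by rewrite mxE.
all: have k1 : k 1 0 = - Y13 by rewrite mxE.
all: have k2 : k 2 0 = Y12 by rewrite mxE.
- have nE : n2 * x1 - n1 * y1 = u 1 0 * Y12 + u 2 0 * Y13.
    by rewrite -e1 -e2 /Y12 /Y13; ring.
  rewrite (vpf_divz _ _ u k 0 2 1 solP) ?k0 ?k1 ?k2 ?oppr_lt0//.
  + rewrite opprK nE sum_floor_fracpart -?nE//; last by lia.
    congr (_ - _ - _ + _); apply: fracpart_modz => //.
    (* Modulo [Y12], [n2 * x1 - n1 * y1] is [u_3 Y13] and [n2 * x2 - n1 * y2] is [u_3 Y23], so [h12]
       cancels the factor of [u_3]. *)
    * transitivity (modz (h12 * (f12 * Y13 + g12 * Y23) * u 2 0) Y12).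
        by rewrite -modzMml h12E modzMml mul1r.
      rewrite -[LHS](modzMDl (h12 * (f12 * u 1 0 - g12 * u 0 0))).
      by congr (_ %% _)%Z; rewrite -e1 -e2 /Y12 /Y13 /Y23; ring.
    * transitivity (modz (h13 * (f13 * Y12 + g13 * Y23) * u 1 0) Y13).
        by rewrite -modzMml h13E modzMml mul1r.
      rewrite -[LHS](modzMDl (h13 * (f13 * u 2 0 + g13 * u 0 0))).
      by congr (_ %% _)%Z; rewrite -e1 -e2 /Y12 /Y13 /Y23; ring.
  + move=> m.
    by have [] := ord3P m => ->; [apply: Or31 | apply: Or33 | apply: Or32].
  (* [ge2] amounts to [u_3 Y23 <= u_1 Y12]. *)
  + move: ge2; rewrite -e1 -e2 -subr_ge0 /Y12 /Y23; lia.
  + by rewrite opprK -nE; lia.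
- have nE : n1 * y3 - n2 * x3 = u 1 0 * Y23 + u 0 0 * Y13.
    by rewrite -e1 -e2 /Y23 /Y13; ring.
  rewrite (vpf_divz _ _ u k 2 0 1 solP) ?k0 ?k1 ?k2 ?oppr_lt0//.
  + rewrite opprK nE sum_floor_fracpart -?nE//; last by lia.
    congr (_ - _ - _ + _); apply: fracpart_modz => //.
    * transitivity (modz (h23 * (f23 * Y13 + g23 * Y12) * u 0 0) Y23).
        by rewrite -modzMml h23E modzMml mul1r.
      rewrite -[LHS](modzMDl (h23 * (f23 * u 1 0 - g23 * u 2 0))).
      by congr (_ %% _)%Z; rewrite -e1 -e2 /Y12 /Y13 /Y23; ring.
    (* This argument equals the one used on the closure of [Omega1], with its terms regrouped. *)
    * transitivity (modz (h13 * (f13 * Y12 + g13 * Y23) * u 1 0) Y13).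
        by rewrite -modzMml h13E modzMml mul1r.
      rewrite -[LHS](modzMDl (h13 * (f13 * u 2 0 + g13 * u 0 0))).
      by congr (_ %% _)%Z; rewrite -e1 -e2 /Y12 /Y13 /Y23; ring.
  + move=> m.
    by have [] := ord3P m => ->; [apply: Or32 | apply: Or33 | apply: Or31].
  + move: ge1; rewrite -e1 -e2 -subr_ge0 /Y12 /Y23; lia.
  + by rewrite opprK -nE; lia.
Qed.
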